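(* Suppose $\mathrm{char}(\mathbb{F}_q)\neq 2$. Let $V=\mathrm{Sym}^2(\mathbb{F}_q^2)$ be the space of binary quadratic forms with the action of $G=\mathrm{GL}_1(\mathbb{F}_q)\times\mathrm{GL}_2(\mathbb{F}_q)$, with $G$-orbits $\mathcal{O}_1,\dots,\mathcal{O}_4$ having the representatives $0$, $v^2$, $uv$, $u^2-lv^2$ respectively ($l\in\mathbb{F}_q^\times$ a non-square), and let $e_i$ be the indicator function of $\mathcal{O}_i$. Let $M=[a_{ij}]$ be the matrix defined by $\widehat{e_j}=\sum_i a_{ij}e_i$. Then $$M=\frac1{q^3}\begin{bmatrix} 1&q^2-1&\frac12q(q^2-1)&\frac12q(q-1)^2\\ 1&-1&\frac12(q^2-q)&-\frac12(q^2-q)\\ 1&q-1&-q&0\\ 1&-(q+1)&0&q \end{bmatrix}.$$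
   Context: $p=\mathrm{char}(\mathbb{F}_q)\ne2$. Elements of $V$ are binary quadratic forms $x(u,v)=au^2+buv+cv^2=(a,b,c)$, and $(g_1,g_2)\in G$ acts by $((g_1,g_2)\cdot x)(u,v)=g_1\,x((u,v)g_2)$. The four orbits listed are distinct and exhaust $V$. The bilinear form is $[x,x']=aa'+bb'/2+cc'$, and for $\phi\colon V\to\mathbb{C}$ the Fourier transform is $$\widehat\phi(y)=q^{-3}\sum_{x\in V}\phi(x)\exp\left(2\pi\sqrt{-1}\cdot\mathrm{Tr}_{\mathbb{F}_q/\mathbb{F}_p}([x,y])/p\right).$$ *)

(* Defs.v *)
From HB Require Import structures.
From mathcomp Require Import all_boot all_order all_algebra all_fingroup all_field.
From mathcomp Require Import reals sequences trigo complex ring.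

Set Implicit Arguments.
Unset Strict Implicit.
Unset Printing Implicit Defensive.

Import GRing.Theory.
Local Open Scope ring_scope.
Local Open Scope complex_scope.

Definition expC (R : realType) (z : R[i]) : R[i] :=
  (expR (complex.Re z))%:C * (cos (complex.Im z) +i* sin (complex.Im z)).

Section Trace.
Variables (F : finFieldType) (p : nat) (charFp : p \in [pchar F]).

(* pPrimeCharType charFp is F viewed as an extension of 'F_p. The library trace
   is valued in the copy of 'F_p inside F; trFp is its preimage in 'F_p. The
   default 0 is never used, by trFpE. *)
Definition trFp (x : F) : 'F_p :=
  let L := pPrimeCharType charFp in
  odflt 0 [pick k : 'F_p | k%:A == galTrace 1%AS {:L} (x : L)].

Lemma trFpE (x : pPrimeCharType charFp) :
  (trFp x)%:A = galTrace 1%AS {: pPrimeCharType charFp} x.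
Proof.
rewrite /trFp; case: pickP => [k /eqP //|nok].
have: galTrace 1%AS {: pPrimeCharType charFp} x \in 1%VS.
  by apply: mem_galTrace; rewrite ?memvf // finField_galois // subvf.
by case/vlineP => k Ek; have := nok k; rewrite Ek eqxx.
Qed.

End Trace.

Section BinaryQuadraticForms.
Variable F : finFieldType.

(* (a, b, c) stands for the form a u^2 + b u v + c v^2. *)
Definition bqf : Type := F * F * F.
HB.instance Definition _ := Finite.on bqf.

(* The values are taken in an arbitrary commutative F-algebra A, such as
   F[u, v], so that forms are not identified with functions on F^2. *)
Definition bqf_eval (A : comAlgType F) (x : bqf) (w : 'rV[A]_2) : A :=
  let: (a, b, c) := x in
  a *: w 0 0 ^+ 2 + b *: (w 0 0 * w 0 1) + c *: w 0 1 ^+ 2.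

(* The coefficients of g1 x((u, v) g2); see bqf_actE. *)
Definition bqf_act (g : {unit F} * {'GL_2[F]}) (x : bqf) : bqf :=
  let: (a, b, c) := x in
  let g1 := val g.1 in let g2 := val g.2 in
  (g1 * (a * g2 0 0 ^+ 2 + b * g2 0 0 * g2 0 1 + c * g2 0 1 ^+ 2),
   g1 * (a * g2 0 0 * g2 1 0 *+ 2 + b * (g2 0 0 * g2 1 1 + g2 0 1 * g2 1 0)
         + c * g2 0 1 * g2 1 1 *+ 2),
   g1 * (a * g2 1 0 ^+ 2 + b * g2 1 0 * g2 1 1 + c * g2 1 1 ^+ 2)).

Lemma bqf_actE (A : comAlgType F) g x (w : 'rV[A]_2) :
  bqf_eval (bqf_act g x) w =
  val g.1 *: bqf_eval x (w *m map_mx (in_alg A) (val g.2)).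
Proof.
case: g x => [g1 g2] [[a b] c].
have c2 (i : 'I_2) : (w *m map_mx (in_alg A) (val g2)) 0 i
    = w 0 0 * (val g2 0 i)%:A + w 0 1 * (val g2 1 i)%:A.
  rewrite mxE big_ord_recl big_ord1 !mxE.
  have -> : lift ord0 ord0 = 1 :> 'I_2 by apply: val_inj.
  by [].
have scE (k : F) (z : A) : k *: z = in_alg A k * z by rewrite mulr_algl.
by rewrite /bqf_eval /bqf_act /= !c2 /= !scE; ring.
Qed.

Definition bqf_orbit (x : bqf) : {set bqf} :=
  [set bqf_act g x | g : {unit F} * {'GL_2[F]}].

(* Representatives 0, v^2, u v, u^2 - l v^2. *)
Definition bqf_repr (l : F) (i : 'I_4) : bqf :=
  nth (0, 0, 0) [:: (0, 0, 0); (0, 0, 1); (0, 1, 0); (1, 0, - l)] i.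

Definition bqf_dot (x y : bqf) : F :=
  let: (a, b, c) := x in let: (a', b', c') := y in
  a * a' + b * b' / 2 + c * c'.

End BinaryQuadraticForms.

Section FourierTransform.
Variables (R : realType) (F : finFieldType).
Variables (p : nat) (charFp : p \in [pchar F]).

(* t : 'F_p is read as its representative in {0, ..., p - 1}. *)
Definition addchar (t : 'F_p) : R[i] :=
  expC ((2 * pi)%:C * 'i%C * (t : nat)%:R / p%:R).

Definition fourier (phi : bqf F -> R[i]) (y : bqf F) : R[i] :=
  (#|F|%:R ^+ 3)^-1 *
    \sum_(x : bqf F) phi x * addchar (trFp charFp (bqf_dot x y)).

Definition orbit_ind (l : F) (i : 'I_4) (x : bqf F) : R[i] :=
  (x \in bqf_orbit (bqf_repr l i))%:R.

End FourierTransform.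

(* Main.v *)
Require Import Defs.
From mathcomp Require Import all_boot all_order all_algebra.
From mathcomp Require Import all_fingroup all_field.
From mathcomp Require Import cyclic reals exp trigo complex ring zify.
Import Order.TTheory GRing.Theory Num.Theory.
Local Open Scope ring_scope.

Set Implicit Arguments.
Unset Strict Implicit.

(** Write psi x = exp(2 pi i Tr(x) / p) and S_j(y) for the sum of psi([x, y])
    over the x in the orbit of index j, so that the transform of e_j at y is
    q^-3 S_j(y). Indices run from 0 to 3.

    The orbits are read off from the discriminant b^2 - 4ac, which an element
    (g1, g2) of G multiplies by the square (g1 det g2)^2: apart from the zero
    form, the orbit records whether the discriminant is zero, a nonzero square
    or a non-square ([mem_bqf_orbit]). The action of (g1, g2) is adjoint to
    that of (g1, g2^T) for the bilinear form, so S_j is constant on every orbit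
    ([orbit_sum_act]). Hence only the numbers T_ij = S_j(y_i), with y_i the
    representatives, matter, and the matrix M is unique because every orbit is
    nonempty.

    To find T_ij it is enough to count very little. Let n_i = T_0i be the size
    of the orbit of index i. Column 0 of T is 1. The orbit of index 1 consists
    of the multiples t (alpha u + beta v)^2 of squares of linear forms, one for
    each t <> 0 and each point (alpha : beta) of the projective line, and
    psi sums over t to q - 1 or -1 according to whether y vanishes at the
    point; so column 1 counts projective zeros of y
    ([orbit_sum_rank1]). Orthogonality of characters says that the rows of T
    sum to q^3 and 0, 0, 0 ([sum_orbit_sum]), and summing psi([x, y]) over a
    pair of orbits in either order gives n_i T_ij = n_j T_ji
    ([orbit_sum_sym]). The last relation comes from y = uv, where [x, y] = b/2:
    multiplying c by the non-square l exchanges the forms (a, 0, c) in the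
    orbits of index 2 and 3, whence
    (q - 1)(T_22 - T_23) = -(n_2 - n_3) ([orbit_sum_split_nonsplit]). These
    linear relations determine T ([orbit_sum_relations]). *)

(** * The additive character *)

Lemma expr_cos_sin (R : realType) (x : R) n :
  (cos x +i* sin x)%C ^+ n = (cos (x *+ n) +i* sin (x *+ n))%C.
Proof.
elim: n => [|n IHn]; first by rewrite mulr0n cos0 sin0.
rewrite exprSr IHn mulrSr cosD sinD; simpc.
by congr (_ +i* _)%C; rewrite addrC.
Qed.

(** A trace is a sum of distinct automorphisms, and distinct automorphisms are
    linearly independent. *)
Lemma galTrace_neq0 (K : fieldType) (L : splittingFieldType K)
    (U V : {subfield L}) :
  exists2 a, a \in V & galTrace U V a != 0.
Proof.
have [a aV nz] := gal_independent_contra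
  (P := mem 'Gal(V / U)%g) (c_ := fun=> 1 : L) (group1 _) (oner_neq0 L).
exists a => //; rewrite /galTrace; under eq_bigr do rewrite -[_ a]mul1r.
exact: nz.
Qed.

Section AdditiveCharacter.
Variables (R : realType) (F : finFieldType).
Variables (p : nat) (charFp : p \in [pchar F]).

Lemma trFpD : {morph trFp charFp : x y / x + y}.
Proof.
move=> x y; apply: (fmorph_inj (in_alg (pPrimeCharType charFp))).
by rewrite rmorphD /= !trFpE -raddfD.
Qed.

(** Some trace is nonzero, and dividing by it, which is allowed because the
    trace is linear over the prime field, yields trace 1. *)
Lemma trFp_onto1 : exists x, trFp charFp x = 1.
Proof.
pose L := pPrimeCharType charFp.
have [z _ tz_neq0] := galTrace_neq0 1%AS {: L}%AS.
have k_neq0 : trFp charFp z != 0.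
  by apply: contra_neq tz_neq0 => k0; rewrite -trFpE k0 scale0r.
exists ((trFp charFp z)^-1 *: z : L).
apply: (fmorph_inj (in_alg L)); rewrite /= trFpE scale1r.
transitivity ((trFp charFp z)^-1 *: galTrace 1%AS {: L} z).
  by rewrite /galTrace scaler_sumr; apply: eq_bigr => s _; rewrite linearZ.
by rewrite -trFpE scalerA mulVf // scale1r.
Qed.

Let zeta : R[i] := (cos (2 * trigo.pi / p%:R) +i* sin (2 * trigo.pi / p%:R))%C.

Lemma addcharE (t : 'F_p) : addchar R t = zeta ^+ (t : nat).
Proof.
rewrite expr_cos_sin /addchar.
(* The real part of the exponent is 0, so only the rotation remains. *)
have -> : ((2 * trigo.pi)%:C * 'i * (t : nat)%:R / p%:R
             = 0 +i* (2 * trigo.pi / p%:R *+ t) :> R[i])%C.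
  rewrite -!(rmorph_nat (real_complex R)) -fmorphV /=.
  by simpc; rewrite -[in RHS]mulr_natr mulrAC.
by rewrite /expC /= expR0 mul1r.
Qed.

Let p_prime : prime p := pcharf_prime charFp.

Lemma zeta_root : zeta ^+ p = 1.
Proof.
have p_neq0 : p%:R != 0 :> R by rewrite pnatr_eq0 -lt0n prime_gt0.
have twopi : 2 * trigo.pi / p%:R *+ p = trigo.pi *+ 2 :> R.
  by rewrite -[LHS]mulr_natr divfK // mulr_natl.
by rewrite expr_cos_sin twopi cos2pi sin2pi.
Qed.

Lemma addcharD (s t : 'F_p) : addchar R (s + t) = addchar R s * addchar R t.
Proof.
(* 'F_p is defined from the least prime divisor of p, so its modulus is only
   provably p. *)
rewrite !addcharE -exprD -[RHS](expr_mod _ zeta_root) /=.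
exact: (congr1 (fun m => zeta ^+ (((s : nat) + t) %% m)%N) (Fp_cast p_prime)).
Qed.

Hypothesis p_neq2 : p != 2%N.

(** For p > 2 the angle 2 pi / p lies strictly between 0 and pi, where the
    sine does not vanish. *)
Lemma addchar1_neq1 : addchar R (1 : 'F_p) != 1.
Proof.
have p_gt2 : (2 < p)%N by rewrite ltn_neqAle eq_sym p_neq2 prime_gt1.
have : 0 < sin (2 * trigo.pi / p%:R : R).
  have pi0 := pi_gt0 R.
  have p0 : 0 < p%:R :> R by rewrite ltr0n prime_gt0.
  apply: sin_gt0_pi; rewrite divr_gt0 ?mulr_gt0 //= ltr_pdivrMr //.
  by rewrite mulrC ltr_pM2l // ltr_nat.
rewrite addcharE expr1 eq_complex /= => /lt0r_neq0 /negPf ->.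
by rewrite andbF.
Qed.

Lemma addchar0 : addchar R (0 : 'F_p) = 1.
Proof. by rewrite addcharE. Qed.

Definition trace_char (x : F) : R[i] := addchar R (trFp charFp x).

Lemma trace_charD : {morph trace_char : x y / x + y >-> x * y}.
Proof. by move=> x y; rewrite /trace_char trFpD addcharD. Qed.

Lemma trace_char_neq1 : exists z, trace_char z != 1.
Proof.
by have [z tz1] := trFp_onto1; exists z; rewrite /trace_char tz1 addchar1_neq1.
Qed.

Lemma trace_char0 : trace_char 0 = 1.
Proof.
rewrite /trace_char; suff -> : trFp charFp 0 = 0 by exact: addchar0.
by apply: (addrI (trFp charFp 0)); rewrite -trFpD !addr0.
Qed.

End AdditiveCharacter.

(** * Orbits of binary quadratic forms *)

(** Non-squares are the odd powers of a generator of the cyclic group of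
    units, so a product of two of them is an even power. *)
Lemma nonsquare_ratio (F : finFieldType) (l d : F) : l != 0 ->
    (forall z : F, z ^+ 2 != l) -> (forall z : F, z ^+ 2 != d) ->
  exists e, d = l * e ^+ 2.
Proof.
move=> l_neq0 nsq_l nsq_d.
have d_neq0 : d != 0 by apply: contraTneq (nsq_d 0) => ->; rewrite expr0n eqxx.
have /cyclicP[g gen_g] := field_unit_group_cyclic [set: {unit F}].
have power (x : F) : x != 0 -> (forall z : F, z ^+ 2 != x) ->
    exists k, x = val g ^+ k.*2.+1.
  move=> x_neq0 nsq_x.
  have ux : x \is a GRing.unit by rewrite unitfE.
  have /cycleP[n gn] : FinRing.unit F ux \in <[g]>%g.
    by rewrite -gen_g inE.
  have xE : x = val g ^+ n by rewrite -FinRing.val_unitX -gn.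
  have [odd_n | even_n] := boolP (odd n).
    by exists n./2; rewrite xE -[in LHS](odd_double_half n) odd_n.
  have := nsq_x (val g ^+ n./2).
  by rewrite -exprM muln2 even_halfK // -xE eqxx.
have [i ->] := power d d_neq0 nsq_d.
have [j lE] := power l l_neq0 nsq_l.
exists (val g ^+ (i + j).+1 / l).
have gj : val g ^+ j.*2.+1 != 0 by rewrite -lE.
rewrite lE; apply: (mulIf gj); rewrite expr_div_n mulrA.
have -> : (val g ^+ (i + j).+1) ^+ 2 = val g ^+ i.*2.+1 * val g ^+ j.*2.+1.
  by rewrite -exprM -exprD; congr (_ ^+ _); lia.
by field.
Qed.

Section Orbits.
Variable F : finFieldType.
Implicit Types (x y : bqf F) (g : {unit F} * {'GL_2[F]}).

Definition disc x : F := let: (a, b, c) := x in b ^+ 2 - 4 * a * c.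

Lemma det2 (A : 'M[F]_2) : \det A = A 0 0 * A 1 1 - A 0 1 * A 1 0.
Proof.
rewrite (expand_det_row _ 0) big_ord_recl big_ord1 /cofactor !det_mx11 !mxE /=.
have -> : lift ord0 ord0 = 1 :> 'I_2 by apply: val_inj.
have -> : lift (1 : 'I_2) 0 = 0 :> 'I_2 by apply: val_inj.
by rewrite /bump /= expr0 mul1r expr1 -[ord0]/(0 : 'I_2); ring.
Qed.

Lemma disc_act g x :
  disc (bqf_act g x) = (val g.1 * \det (val g.2)) ^+ 2 * disc x.
Proof. by case: x => [[a b] c]; rewrite det2 /=; ring. Qed.

Lemma unit_val_neq0 (u : {unit F}) : val u != 0.
Proof. by rewrite -unitfE (valP u). Qed.

Lemma GL_det_neq0 (u : {'GL_2[F]}) : \det (val u) != 0.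
Proof. by rewrite -unitfE -unitmxE (valP u). Qed.

Lemma mulmx2E (A B : 'M[F]_2) i j :
  (A *m B) i j = A i 0 * B 0 j + A i 1 * B 1 j.
Proof.
rewrite mxE big_ord_recl big_ord1.
by have -> : lift ord0 ord0 = 1 :> 'I_2 by apply: val_inj.
Qed.

Lemma bqf_actM g h x : bqf_act (g * h)%g x = bqf_act g (bqf_act h x).
Proof.
case: x g h => [[a b] c] [g1 g2] [h1 h2] /=.
rewrite !(mulmx2E (val g2) (val h2)).
by congr (_, _, _); ring.
Qed.

Lemma bqf_act1 x : bqf_act 1%g x = x.
Proof.
case: x => [[a b] c] /=; rewrite !mxE /=.
by congr (_, _, _); ring.
Qed.

Lemma bqf_eq0 (a b c : F) :
  ((a, b, c) == (0, 0, 0) :> bqf F) = [&& a == 0, b == 0 & c == 0].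
Proof. by rewrite -[LHS]/((_ && _) && _) andbA. Qed.

Lemma bqf_act_inj g : injective (bqf_act g).
Proof.
apply: (can_inj (g := bqf_act g^-1%g)) => x.
by rewrite -bqf_actM mulVg bqf_act1.
Qed.

Definition bqf_tr g : {unit F} * {'GL_2[F]} := (g.1, insubd g.2 (val g.2)^T).

Lemma val_bqf_tr g : val (bqf_tr g).2 = (val g.2)^T.
Proof. by rewrite val_insubd unitmx_tr (valP g.2). Qed.

Hypothesis F2 : 2 != 0 :> F.

Let F4 : 4 != 0 :> F.
Proof. by rewrite (natrM _ 2 2) mulf_neq0. Qed.

(** On symmetric matrices the bilinear form is tr(X Y) and g2 acts by
    X |-> g2 X g2^T, which is cyclic under the trace. *)
Lemma bqf_dot_adj g x y :
  bqf_dot (bqf_act g x) y = bqf_dot x (bqf_act (bqf_tr g) y).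
Proof.
case: x y => [[a b] c] [[a' b'] c'].
by rewrite /bqf_act val_bqf_tr /= !mxE; field.
Qed.

(** The index, in the order of [bqf_repr], of the orbit of the zero, degenerate,
    split and non-split forms respectively. *)
Definition bqf_class x : 'I_4 :=
  if x == (0, 0, 0) then 0 else if disc x == 0 then 1 else
  if [exists z, disc x == z ^+ 2] then 2 else 3.

Lemma bqf_act0 g : bqf_act g (0, 0, 0) = (0, 0, 0).
Proof. by rewrite /bqf_act; congr (_, _, _); ring. Qed.

Lemma bqf_class_act g x : bqf_class (bqf_act g x) = bqf_class x.
Proof.
rewrite /bqf_class -{1}(bqf_act0 g) (inj_eq (@bqf_act_inj g)) disc_act.
set k := val g.1 * \det (val g.2).
have k_neq0 : k != 0 by rewrite mulf_neq0 ?unit_val_neq0 ?GL_det_neq0.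
clearbody k.
rewrite mulf_eq0 expf_eq0 /= (negPf k_neq0) /=.
do 2?[case: ifP => // _].
congr (if _ then _ else _); apply/existsP/existsP => -[z /eqP Ez].
  exists (z / k); apply/eqP; rewrite expr_div_n -Ez mulrC mulKf //.
  by rewrite expf_neq0.
by exists (k * z); apply/eqP; rewrite Ez exprMn.
Qed.

Lemma bqf_act_exists k m00 m01 m10 m11 :
    k != 0 -> m00 * m11 - m01 * m10 != 0 ->
  exists g, forall a b c, bqf_act g (a, b, c) =
    (k * (a * m00 ^+ 2 + b * m00 * m01 + c * m01 ^+ 2),
     k * (a * m00 * m10 *+ 2 + b * (m00 * m11 + m01 * m10)
          + c * m01 * m11 *+ 2),
     k * (a * m10 ^+ 2 + b * m10 * m11 + c * m11 ^+ 2)).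
Proof.
move=> k_neq0 det_neq0.
have uk : k \is a GRing.unit by rewrite unitfE.
pose A : 'M[F]_2 := \matrix_(i, j)
  (if i == 0 then if j == 0 then m00 else m01
   else if j == 0 then m10 else m11).
have uA : A \is a GRing.unit by rewrite unitmxE unitfE det2 !mxE.
exists (FinRing.unit F uk, FinRing.unit 'M[F]_2 uA) => a b c.
by rewrite /bqf_act /= !mxE.
Qed.

Section Classification.
Variable l : F.
Hypotheses (l_neq0 : l != 0) (l_nonsquare : forall z : F, z ^+ 2 != l).

Lemma bqf_class_repr i : bqf_class (bqf_repr l i) = i.
Proof.
case: i => [[|[|[|[|//]]]] lt_i]; apply: val_inj;
  rewrite /bqf_class /= bqf_eq0 ?eqxx ?oner_eq0 ?andbF //=.
- by rewrite !mulr0 mul0r expr0n subrr eqxx.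
- rewrite !mulr0 subr0 expr1n oner_eq0 ifT //.
  by apply/existsP; exists 1; rewrite expr1n.
have -> : 0 ^+ 2 - 4 * 1 * - l = 2 ^+ 2 * l by ring.
rewrite mulf_eq0 expf_eq0 /= (negPf F2) (negPf l_neq0) /= ifF //.
apply/existsP => -[z /eqP Ez]; have /eqP := l_nonsquare (z / 2); apply.
by rewrite expr_div_n -Ez mulrC mulKf // expf_neq0.
Qed.

(** Completing the square: 4 c x = (2 c v + b u)^2 - D u^2 with D the
    discriminant, when c is nonzero. If D = d^2 the right-hand side factors into
    two linear forms, and if D = l e^2 it is the norm form in 2 c v + b u and
    e u. The matrices below are these substitutions, scaled. A form with
    c = 0 is u (a u + b v). *)
Lemma bqf_act_repr x : exists g, x = bqf_act g (bqf_repr l (bqf_class x)).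
Proof.
rewrite /bqf_class.
case: eqVneq => [->|]; first by exists 1%g; rewrite bqf_act1.
case: x => [[a b] c] x_neq0.
have [disc0|disc_neq0] := eqVneq.
  have [c0|c_neq0] := eqVneq c 0.
    have b0 : b = 0.
      by move/eqP: disc0; rewrite /= c0 mulr0 subr0 expf_eq0 => /eqP.
    have a_neq0 : a != 0 by apply: contraNneq x_neq0 => ->; rewrite b0 c0.
    have [|g Eg] := @bqf_act_exists a 0 1 1 0 a_neq0.
      by rewrite mul0r mul1r sub0r oppr_eq0 oner_neq0.
    by exists g; rewrite Eg b0 c0; congr (_, _, _); ring.
  have [|g Eg] := @bqf_act_exists c 1 (b / (2 * c)) 0 1 c_neq0.
    by rewrite mulr0 mul1r subr0 oner_neq0.
  exists g; rewrite Eg; congr (_, _, _); [|field|ring]; rewrite ?c_neq0 //.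
  (* The coefficients of u^2 differ by a multiple of the discriminant. *)
  apply/eqP; rewrite -subr_eq0; apply/eqP.
  transitivity (- disc (a, b, c) / (4 * c)); last by rewrite disc0 oppr0 mul0r.
  by rewrite /=; field; rewrite F4 F2 c_neq0.
case: ifP => [/existsP[d /eqP Ed]|/negbT nsq].
  have d_neq0 : d != 0.
    by apply: contraNneq disc_neq0 => d0; rewrite Ed d0 expr0n.
  have [c0|c_neq0] := eqVneq c 0.
    have b_neq0 : b != 0.
      by apply: contraNneq disc_neq0 => b0; rewrite /= b0 c0; apply/eqP; ring.
    have [|g Eg] := @bqf_act_exists 1 1 a 0 b (oner_neq0 _).
      by rewrite mulr0 mul1r subr0.
    by exists g; rewrite Eg c0; congr (_, _, _); ring.
  have [|g Eg] :=
    @bqf_act_exists c ((b + d) / (2 * c)) ((b - d) / (2 * c)) 1 1 c_neq0.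
    have -> : (b + d) / (2 * c) * 1 - (b - d) / (2 * c) * 1 = d / c.
      by field; rewrite c_neq0.
    by rewrite mulf_neq0 ?invr_eq0.
  exists g; rewrite Eg; congr (_, _, _); [|field|ring]; rewrite ?c_neq0 //.
  apply/eqP; rewrite -subr_eq0; apply/eqP.
  transitivity ((d ^+ 2 - disc (a, b, c)) / (4 * c)).
    by rewrite /=; field; rewrite F4 F2 c_neq0.
  by rewrite Ed subrr mul0r.
have [|e Ee] := nonsquare_ratio (d := disc (a, b, c)) l_neq0 l_nonsquare.
  move=> z; rewrite eq_sym; apply: contraNneq nsq => Ez.
  by apply/existsP; exists z; apply/eqP.
have e_neq0 : e != 0.
  by apply: contraNneq disc_neq0 => e0; rewrite Ee e0 expr0n mulr0.
(* If c vanished, the discriminant would be the square b^2. *)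
have c_neq0 : c != 0.
  apply: contraNneq nsq => c0; apply/existsP; exists b.
  by rewrite /= c0 mulr0 subr0.
have [|g Eg] := @bqf_act_exists c (b / (2 * c)) (e / (2 * c)) 1 0 c_neq0.
  rewrite mulr0 mulr1 sub0r oppr_eq0 mulf_neq0 ?invr_eq0 //.
  by rewrite mulf_neq0.
exists g; rewrite Eg; congr (_, _, _); [|field|ring]; rewrite ?c_neq0 //.
apply/eqP; rewrite -subr_eq0; apply/eqP.
transitivity ((l * e ^+ 2 - disc (a, b, c)) / (4 * c)).
  by rewrite /=; field; rewrite F4 F2 c_neq0.
by rewrite Ee subrr mul0r.
Qed.

Lemma mem_bqf_orbit x i :
  (x \in bqf_orbit (bqf_repr l i)) = (bqf_class x == i).
Proof.
apply/imsetP/eqP => [[g _ ->]|<-].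
  by rewrite bqf_class_act bqf_class_repr.
by have [g Eg] := bqf_act_repr x; exists g.
Qed.

End Classification.
End Orbits.

(** * Exponential sums over the orbits *)

Lemma ord4_ind (P : 'I_4 -> Prop) : P 0 -> P 1 -> P 2 -> P 3 -> forall i, P i.
Proof.
move=> P0 P1 P2 P3 [[|[|[|[|//]]]] lt_i].
- by rewrite (_ : Ordinal lt_i = 0) //; apply: val_inj.
- by rewrite (_ : Ordinal lt_i = 1) //; apply: val_inj.
- by rewrite (_ : Ordinal lt_i = 2) //; apply: val_inj.
- by rewrite (_ : Ordinal lt_i = 3) //; apply: val_inj.
Qed.

Definition orbit_table (C : fieldType) (q : C) (i j : 'I_4) : C :=
  nth 0 (nth [::]
  [:: [:: 1; q ^+ 2 - 1; 1 / 2 * q * (q ^+ 2 - 1); 1 / 2 * q * (q - 1) ^+ 2];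
      [:: 1; -1; 1 / 2 * (q ^+ 2 - q); - (1 / 2 * (q ^+ 2 - q))];
      [:: 1; q - 1; - q; 0];
      [:: 1; - (q + 1); 0; q]] i) j.

(** The first four equations are the row sums, with the known entries filled in.
    The two symmetry relations of row 1, together with its sum, give
    n2 (q - 1) = n3 (q + 1), which with row 0 fixes the two orbit sizes; the
    other entries follow one at a time. *)
Lemma orbit_sum_relations (C : fieldType)
    (q n2 n3 t12 t13 t22 t23 t32 t33 : C) :
    q != 0 -> q - 1 != 0 -> q + 1 != 0 -> 2 != 0 :> C ->
    1 + (q ^+ 2 - 1) + n2 + n3 = q ^+ 3 ->
    1 + (-1) + t12 + t13 = 0 ->
    1 + (q - 1) + t22 + t23 = 0 ->
    1 - (q + 1) + t32 + t33 = 0 ->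
    (q ^+ 2 - 1) * t12 = n2 * (q - 1) ->
    (q ^+ 2 - 1) * t13 = n3 * - (q + 1) ->
    n3 * t32 = n2 * t23 ->
    (q - 1) * (t22 - t23) = - (n2 - n3) ->
  [/\ n2 = 1 / 2 * q * (q ^+ 2 - 1), n3 = 1 / 2 * q * (q - 1) ^+ 2,
      t12 = 1 / 2 * (q ^+ 2 - q), t13 = - (1 / 2 * (q ^+ 2 - q))
    & [/\ t22 = - q, t23 = 0, t32 = 0 & t33 = q]].
Proof.
move=> q0 q1 qp1 two row0 row1 row2 row3 sym12 sym13 sym32 swap.
have n3E : n3 = q ^+ 3 - q ^+ 2 - n2 by rewrite -row0; ring.
have t13E : t13 = - t12.
  by apply: (addrI t12); rewrite subrr -row1; ring.
have t22E : t22 = - q - t23.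
  by apply: (addIr (q + t23)); transitivity (0 : C); [rewrite -row2|]; ring.
have t33E : t33 = q - t32.
  by apply: (addIr (- q + t32)); transitivity (0 : C); [rewrite -row3|]; ring.
have n2E : n2 = 1 / 2 * q * (q ^+ 2 - 1).
  apply: (mulIf (mulf_neq0 two q0)).
  transitivity (n2 * (q - 1) + n2 * (q + 1)); first by ring.
  by rewrite -sym12 -[t12]opprK -t13E mulrN sym13 n3E; field.
have {}n3E : n3 = 1 / 2 * q * (q - 1) ^+ 2 by rewrite n3E n2E; field.
have qq0 : q ^+ 2 - 1 != 0.
  rewrite (_ : _ - _ = (q - 1) * (q + 1)) ?mulf_neq0 //; ring.
have t12E : t12 = 1 / 2 * (q ^+ 2 - q).
  by apply: (mulfI qq0); rewrite sym12 n2E; field.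
have t23E : t23 = 0.
  apply: (mulfI q1); apply: (mulfI two); rewrite mulr0.
  transitivity ((q - 1) * (- q) - (q - 1) * (t22 - t23)).
    by rewrite t22E; ring.
  by rewrite swap n2E n3E; field.
have t32E : t32 = 0.
  have n3_neq0 : n3 != 0 by rewrite n3E !mulf_neq0 ?invr_eq0 ?oner_neq0.
  by apply: (mulfI n3_neq0); rewrite sym32 t23E !mulr0.
by rewrite t13E t22E t33E t12E t23E t32E n2E n3E !subr0.
Qed.

Section OrbitSums.
Variables (F : finFieldType) (C : numFieldType) (psi : F -> C).
Hypotheses (psi0 : psi 0 = 1) (psiD : {morph psi : x y / x + y >-> x * y}).
Hypothesis (psi_neq1 : exists z, psi z != 1).
Hypothesis F2 : 2 != 0 :> F.
Implicit Types x y : bqf F.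
Let q : C := #|F|%:R.

Lemma sum_psi (k : F) : \sum_(t : F) psi (t * k) = q *+ (k == 0).
Proof.
have [->|k_neq0] := eqVneq k 0.
  under eq_bigr do rewrite mulr0 psi0.
  by rewrite sumr_const.
have [z psiz] := psi_neq1.
have shift : \sum_(t : F) psi (t * k) = psi z * \sum_(t : F) psi (t * k).
  rewrite [LHS](reindex_inj (addrI (z / k))) mulr_sumr; apply: eq_bigr => t _.
  by rewrite /= mulrDl divfK // psiD.
apply/eqP; rewrite mulr0n; move/eqP: shift.
rewrite -subr_eq0 -{1}[X in X - _]mul1r -mulrBl mulf_eq0 subr_eq0 eq_sym.
by rewrite (negPf psiz).
Qed.

Lemma sum_psi_neq0 (k : F) :
  \sum_(t : F | t != 0) psi (t * k) = q *+ (k == 0) - 1.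
Proof. by rewrite -sum_psi [in RHS](bigD1 0) //= mul0r psi0 addrC addrK. Qed.

Definition orbit_sum (i : 'I_4) y : C :=
  \sum_x (bqf_class x == i)%:R * psi (bqf_dot x y).

Lemma bqf_dotC x y : bqf_dot x y = bqf_dot y x.
Proof.
case: x y => [[a b] c] [[a' b'] c'] /=.
by rewrite !(mulrC a) !(mulrC b) !(mulrC c).
Qed.

(** Move g across the bilinear form, and reindex by its adjoint. *)
Lemma orbit_sum_act g i y : orbit_sum i (bqf_act g y) = orbit_sum i y.
Proof.
rewrite /orbit_sum [RHS](reindex_inj (@bqf_act_inj _ (bqf_tr g))).
apply: eq_bigr => x _; rewrite bqf_class_act; congr (_ * psi _).
by rewrite bqf_dotC bqf_dot_adj // bqf_dotC.
Qed.

Lemma sum_bqf (f : bqf F -> C) : \sum_x f x = \sum_a \sum_b \sum_c f (a, b, c).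
Proof.
rewrite (pair_bigA _ (fun a b => \sum_c f (a, b, c))) /=.
rewrite (pair_bigA _ (fun ab c => f (ab.1, ab.2, c))) /=.
by apply: eq_bigr => -[[a b] c].
Qed.

(** The orbits partition the space of forms, over which psi([x, y]) is a product
    of three sums in one variable each. *)
Lemma sum_orbit_sum y : \sum_i orbit_sum i y = q ^+ 3 *+ (y == (0, 0, 0)).
Proof.
rewrite exchange_big /=.
transitivity (\sum_x psi (bqf_dot x y)).
  apply: eq_bigr => x _; rewrite (bigD1 (bqf_class x)) //= eqxx mul1r.
  by rewrite big1 ?addr0 // => i /negPf; rewrite eq_sym => ->; rewrite mul0r.
case: y => [[a' b'] c']; rewrite sum_bqf /=.
under eq_bigr => a _.
  under eq_bigr => b _.
    under eq_bigr => c _ do rewrite -mulrA !psiD.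
    rewrite -mulr_sumr sum_psi; over.
  rewrite -mulr_suml -mulr_sumr sum_psi; over.
rewrite -!mulr_suml sum_psi bqf_eq0.
have -> : (b' / 2 == 0) = (b' == 0).
  by rewrite mulf_eq0 invr_eq0 (negPf F2) orbF.
do 3!case: eqP => _; rewrite /= ?mulr1n ?mulr0n ?mulr0 ?mul0r //.
by rewrite -expr2 -exprSr.
Qed.

Lemma bqf_class_eq0 x : (bqf_class x == 0) = (x == (0, 0, 0)).
Proof. by rewrite /bqf_class; do 3!case: ifP => // _. Qed.

Lemma bqf_class_eq1 x : (bqf_class x == 1) = (x != (0, 0, 0)) && (disc x == 0).
Proof. by rewrite /bqf_class; do 3!case: ifP => // _. Qed.

Lemma sum_delta (T : finType) (f : T -> C) t0 :
  \sum_t (t == t0)%:R * f t = f t0.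
Proof.
rewrite (bigD1 t0) //= eqxx mul1r big1 ?addr0 // => t /negPf ->.
by rewrite mul0r.
Qed.

Lemma orbit_sum0 y : orbit_sum 0 y = 1.
Proof.
rewrite /orbit_sum; under eq_bigr do rewrite bqf_class_eq0.
by case: y => [[a b] c]; rewrite sum_delta /= !mul0r !addr0 psi0.
Qed.

(** The first factor of the product is the number of zeros of the form on the
    projective line: (a == 0)%:R counts (1 : 0), and the sum counts the points
    (t : 1). The degenerate forms are the r (alpha u + beta v)^2: those with
    c0 = 0 are r u^2, and the others are c0 (t u + v)^2, with coefficients
    (c0 t^2, 2 c0 t, c0). *)
Lemma orbit_sum_rank1 (a b c : F) : orbit_sum 1 (a, b, c) =
  q * ((a == 0)%:R + \sum_t (a * t ^+ 2 + b * t + c == 0)%:R) - (q + 1).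
Proof.
have F4 : 4 != 0 :> F by rewrite (natrM _ 2 2) mulf_neq0.
have rank1_c0 (a0 b0 : F) :
    (bqf_class (a0, b0, 0) == 1) = (b0 == 0) && (a0 != 0).
  rewrite bqf_class_eq1 bqf_eq0 /= mulr0 subr0 expf_eq0 /= eqxx andbT.
  by case: (b0 == 0); rewrite ?andbT ?andbF.
have rank1_cN0 (a0 t c0 : F) : c0 != 0 ->
    (bqf_class (a0, 2 * c0 * t, c0) == 1) = (a0 == c0 * t ^+ 2).
  move=> c0_neq0; rewrite bqf_class_eq1 bqf_eq0 (negPf c0_neq0) !andbF /=.
  have -> : (2 * c0 * t) ^+ 2 - 4 * a0 * c0 = 4 * c0 * (c0 * t ^+ 2 - a0).
    by ring.
  by rewrite !mulf_eq0 (negPf F4) (negPf c0_neq0) /= subr_eq0 eq_sym.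
pose f (a0 b0 c0 : F) : C :=
  (bqf_class (a0, b0, c0) == 1)%:R * psi (bqf_dot (a0, b0, c0) (a, b, c)).
have line0 : \sum_b0 \sum_a0 f a0 b0 0 = q *+ (a == 0) - 1.
  rewrite -sum_psi_neq0 [RHS]big_mkcond.
  transitivity (\sum_b0 (b0 == 0)%:R *
      \sum_a0 (a0 != 0)%:R * psi (a0 * a + b0 * b / 2)).
    apply: eq_bigr => b0 _; rewrite mulr_sumr; apply: eq_bigr => a0 _.
    by rewrite /f rank1_c0 /= mul0r addr0 mulrA -natrM mulnb.
  rewrite sum_delta; apply: eq_bigr => a0 _; rewrite !mul0r addr0.
  by case: eqP; rewrite ?mul1r ?mul0r.
have lineN0 c0 : c0 != 0 ->
    \sum_b0 \sum_a0 f a0 b0 c0 = \sum_t psi (c0 * (a * t ^+ 2 + b * t + c)).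
  move=> c0_neq0; have k_neq0 : 2 * c0 != 0 by rewrite mulf_neq0.
  rewrite (reindex_inj (mulfI k_neq0)); apply: eq_bigr => t _.
  under eq_bigr => a0 _ do rewrite /f rank1_cN0 //.
  by rewrite sum_delta; congr psi; rewrite /=; field.
transitivity (\sum_c0 \sum_b0 \sum_a0 f a0 b0 c0).
  rewrite /orbit_sum sum_bqf; under eq_bigr do rewrite exchange_big.
  rewrite exchange_big; apply: eq_bigr => c0 _; exact: exchange_big.
rewrite (bigD1 0) //= line0 (eq_bigr _ lineN0) exchange_big /=.
under eq_bigr do rewrite sum_psi_neq0.
rewrite big_split /= sumr_const cardT -cardE.
rewrite mulrDr mulr_sumr mulr_natr -/q mulNrn.
under [X in _ + X - _]eq_bigr do rewrite mulr_natr.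
by rewrite -/q; ring.
Qed.

Lemma card_gt1 : 1 < q.
Proof. by rewrite ltr1n; exact: (finNzRing_gt1 F). Qed.

Section Representatives.
Variable l : F.
Hypotheses (l_neq0 : l != 0) (l_nonsquare : forall z : F, z ^+ 2 != l).

Let T i j := orbit_sum j (bqf_repr l i).
Let n i := T 0 i.

Lemma orbit_sumE j y : orbit_sum j y = orbit_sum j (bqf_repr l (bqf_class y)).
Proof.
have [g ->] := bqf_act_repr F2 l_neq0 l_nonsquare y.
by rewrite orbit_sum_act bqf_class_act // bqf_class_repr.
Qed.

(** Both sides are the sum of psi([x, y]) over x and y in the two orbits, since
    S_j is constant on the orbit of index i. *)
Lemma orbit_sum_sym i j : n i * T i j = n j * T j i.
Proof.
have weighted i' j' : n i' * T i' j' = \sum_y \sum_x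
    (bqf_class y == i')%:R * (bqf_class x == j')%:R * psi (bqf_dot x y).
  rewrite /n {1}/T {1}/orbit_sum mulr_suml; apply: eq_bigr => y _.
  have -> : bqf_dot y (bqf_repr l 0) = 0.
    by case: y => [[a b] c] /=; rewrite !mulr0 mul0r !addr0.
  rewrite psi0 mulr1; case: eqP => [<-|_]; last first.
    by rewrite mul0r big1 // => x _; rewrite !mul0r.
  by rewrite mul1r /T -orbit_sumE; apply: eq_bigr => x _; rewrite mul1r.
rewrite !weighted exchange_big; apply: eq_bigr => x _; apply: eq_bigr => y _.
by rewrite bqf_dotC [_%:R * _%:R]mulrC.
Qed.

(** The quadratic character of the discriminant, by [disc_signE]. *)
Definition disc_sign x : C := (bqf_class x == 2)%:R - (bqf_class x == 3)%:R.

Lemma disc_signE x : disc_sign x =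
  if disc x == 0 then 0 else if [exists z, disc x == z ^+ 2] then 1 else -1.
Proof.
rewrite /disc_sign /bqf_class; case: (x =P (0, 0, 0)) => [->|_] /=.
  by rewrite mulr0 expr0n !subrr eqxx.
by do 2?case: ifP => _ /=; rewrite ?subrr ?subr0 ?sub0r.
Qed.

Lemma disc_sign_twist (a c : F) :
  disc_sign (a, 0, l * c) = - disc_sign (a, 0, c).
Proof.
rewrite !disc_signE.
have -> : disc (a, 0, l * c) = l * disc (a, 0, c) by rewrite /=; ring.
rewrite mulf_eq0 (negPf l_neq0) /=; set d := _ - _.
have [_|d_neq0] := eqVneq d 0; first by rewrite oppr0.
have [/existsP[w /eqP Ew]|nsq_d] := boolP [exists z, d == z ^+ 2].
  rewrite ifF //; apply/existsP => -[z /eqP Ez].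
  have w_neq0 : w != 0.
    by apply: contraNneq d_neq0 => w0; rewrite Ew w0 expr0n.
  have /eqP := l_nonsquare (z / w); apply.
  by rewrite expr_div_n -Ez -Ew mulfK.
have [|e Ee] := nonsquare_ratio (d := d) l_neq0 l_nonsquare.
  by move=> z; apply: contraNneq nsq_d => <-; apply/existsP; exists z.
rewrite opprK ifT //; apply/existsP; exists (l * e).
by rewrite Ee exprMn mulrA.
Qed.

(** Pairing with uv gives b/2, so the difference on the left is the sum of
    psi(b/2) weighted by [disc_sign]. Averaging over the scalings of the forms,
    which preserve the sign, replaces psi(b/2) by q/(q - 1) if b = 0, minus
    1/(q - 1). The forms with b = 0 cancel out by [disc_sign_twist]. *)
Lemma orbit_sum_split_nonsplit : (q - 1) * (T 2 2 - T 2 3) = - (n 2 - n 3).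
Proof.
have ndiff : n 2 - n 3 = \sum_x disc_sign x.
  rewrite /n /T /orbit_sum -sumrB; apply: eq_bigr => -[[a b] c] _ /=.
  by rewrite !mulr0 mul0r !addr0 psi0 !mulr1.
have Tdiff : T 2 2 - T 2 3 = \sum_x disc_sign x * psi (x.1.2 / 2).
  rewrite /T /orbit_sum -sumrB; apply: eq_bigr => -[[a b] c] _ /=.
  by rewrite !mulr0 add0r addr0 mulr1 -mulrBl.
have q1 : q - 1 = \sum_(t : F | t != 0) 1.
  have := sum_psi_neq0 0; rewrite eqxx mulr1n => <-.
  by apply: eq_bigr => t _; rewrite mulr0 psi0.
rewrite q1 mulr_suml Tdiff.
transitivity (\sum_(t | t != 0) \sum_x disc_sign x * psi (t * (x.1.2 / 2))).
  apply: eq_bigr => t t_neq0; rewrite mul1r.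
  have [|g Eg] := @bqf_act_exists F t 1 0 0 1 t_neq0.
    by rewrite mul0r mul1r subr0 oner_neq0.
  rewrite [LHS](reindex_inj (@bqf_act_inj _ g)); apply: eq_bigr => -[[a b] c] _.
  by rewrite /disc_sign !bqf_class_act Eg /=; congr (_ * psi _); ring.
rewrite exchange_big /=.
under eq_bigr => x _ do rewrite -mulr_sumr sum_psi_neq0 mulrBr mulr1.
rewrite sumrB -ndiff.
suff -> : \sum_x disc_sign x * (q *+ (x.1.2 / 2 == 0)) = 0 by rewrite sub0r.
pose W := \sum_a \sum_c disc_sign (a, 0, c).
have W0 : W = 0.
  have /eqP : W = - W.
    rewrite {1}/W /W -sumrN; apply: eq_bigr => a _.
    rewrite -sumrN (reindex_inj (mulfI l_neq0)); apply: eq_bigr => c _.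
    exact: disc_sign_twist.
  by rewrite -addr_eq0 -mulr2n mulrn_eq0 => /eqP.
rewrite sum_bqf /=; transitivity (q * W); last by rewrite W0 mulr0.
rewrite mulr_sumr; apply: eq_bigr => a _.
transitivity (\sum_b (b == 0)%:R * (q * \sum_c disc_sign (a, b, c)));
  last exact: sum_delta.
apply: eq_bigr => b _; rewrite !mulr_sumr; apply: eq_bigr => c _.
rewrite mulf_eq0 invr_eq0 (negPf F2) orbF.
by case: eqP => _; rewrite ?mulr1n ?mulr0n ?mulr0 ?mul0r // mul1r mulrC.
Qed.

Lemma orbit_sum_rank1_repr i : T i 1 =
  nth 0 [:: q ^+ 2 - 1; -1; q - 1; - (q + 1)] i.
Proof.
rewrite /T; case: i => [[|[|[|[|//]]]] lt_i];
  rewrite [bqf_repr _ _]/= orbit_sum_rank1 /= ?eqxx ?oner_eq0.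
- under eq_bigr do rewrite !mul0r !addr0 eqxx.
  by rewrite sumr_const !mulr1n -/q; ring.
- rewrite big1 ?mulr1n => [|t _]; first by ring.
  by rewrite !mul0r !add0r oner_eq0.
- under eq_bigr do rewrite mul0r mul1r add0r addr0 -[_%:R]mulr1.
  by rewrite (sum_delta (fun=> 1)) mulr1n; ring.
rewrite big1 ?mulr0n => [|t _]; first by ring.
by rewrite mul1r mul0r addr0 subr_eq0 (negPf (l_nonsquare t)).
Qed.

Lemma orbit_sum_repr i j : orbit_sum j (bqf_repr l i) = orbit_table q i j.
Proof.
have q_gt1 := card_gt1.
have q_neq0 : q != 0 by rewrite gt_eqF // (lt_trans ltr01).
have qB_neq0 : q - 1 != 0 by rewrite subr_eq0 gt_eqF.
have qD_neq0 : q + 1 != 0 by rewrite gt_eqF // addr_gt0 // (lt_trans ltr01).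
have C2 : 2 != 0 :> C by rewrite pnatr_eq0.
have col0 k : T k 0 = 1 by exact: orbit_sum0.
have [t01 t11 t21 t31] : [/\ T 0 1 = q ^+ 2 - 1, T 1 1 = -1,
    T 2 1 = q - 1 & T 3 1 = - (q + 1)].
  by split; rewrite orbit_sum_rank1_repr.
have row k : 1 + T k 1 + T k 2 + T k 3 = q ^+ 3 *+ (k == 0).
  have := sum_orbit_sum (bqf_repr l k).
  rewrite !big_ord_recl big_ord0 -bqf_class_eq0 bqf_class_repr // addr0 => <-.
  by rewrite -[X in _ = X + _]/(T k 0) col0 -!addrA.
have [n2E n3E t12 t13 [t22 t23 t32 t33]] :
  [/\ T 0 2 = 1 / 2 * q * (q ^+ 2 - 1),
    T 0 3 = 1 / 2 * q * (q - 1) ^+ 2, T 1 2 = 1 / 2 * (q ^+ 2 - q),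
    T 1 3 = - (1 / 2 * (q ^+ 2 - q))
    & [/\ T 2 2 = - q, T 2 3 = 0, T 3 2 = 0 & T 3 3 = q]].
  have sym12 := orbit_sum_sym 1 2; have sym13 := orbit_sum_sym 1 3.
  have sym32 := orbit_sum_sym 3 2; rewrite /n t01 t21 in sym12.
  rewrite /n t01 t31 in sym13.
  have r0 := row 0; rewrite t01 in r0; have r1 := row 1; rewrite t11 in r1.
  have r2 := row 2; rewrite t21 in r2; have r3 := row 3; rewrite t31 in r3.
  exact: (orbit_sum_relations q_neq0 qB_neq0 qD_neq0 C2 r0 r1 r2 r3 sym12 sym13
    sym32 orbit_sum_split_nonsplit).
rewrite -/(T i j).
by move: i j; apply: ord4_ind; apply: ord4_ind.
Qed.

End Representatives.
End OrbitSums.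

(** * The Fourier matrix *)

Theorem theorem15 (R : realType) (F : finFieldType) (p : nat)
    (charFp : p \in [pchar F]) (p_neq2 : p != 2%N)
    (l : F) (l_neq0 : l != 0) (l_nonsquare : forall z : F, z ^+ 2 != l)
    (M : 'M[R[i]]_4) :
  (forall (j : 'I_4) (y : bqf F),
     fourier charFp (orbit_ind R l j) y
     = \sum_(i < 4) M i j * orbit_ind R l i y)
  <->
  M = let q : R[i] := #|F|%:R in
      (q ^+ 3)^-1 *: \matrix_(i < 4, j < 4) nth 0 (nth [::]
        [:: [:: 1; q ^+ 2 - 1; 1 / 2 * q * (q ^+ 2 - 1); 1 / 2 * q * (q - 1) ^+ 2];
            [:: 1; -1; 1 / 2 * (q ^+ 2 - q); - (1 / 2 * (q ^+ 2 - q))];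
            [:: 1; q - 1; - q; 0];
            [:: 1; - (q + 1); 0; q]] i) j.
Proof.
have F2 : 2 != 0 :> F.
  rewrite -(dvdn_pcharf charFp) dvdn_prime2 //.
  exact: pcharf_prime charFp.
set q : R[i] := #|F|%:R.
pose S := orbit_sum (trace_char R charFp).
have fourierE j y : fourier charFp (orbit_ind R l j) y = (q ^+ 3)^-1 * S j y.
  congr (_ * _); apply: eq_bigr => x _.
  by rewrite /orbit_ind mem_bqf_orbit.
have expansion (N : 'M[R[i]]_4) j y :
    \sum_i N i j * orbit_ind R l i y = N (bqf_class y) j.
  rewrite -(sum_delta (fun i => N i j)); apply: eq_bigr => i _.
  by rewrite /orbit_ind mem_bqf_orbit // eq_sym mulrC.
have SE i j : S j (bqf_repr l i) = orbit_table q i j.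
  apply: orbit_sum_repr => //; first exact: trace_char0.
    exact: trace_charD.
  exact: trace_char_neq1.
split=> [M_fourier | -> j y].
  apply/matrixP => i j; rewrite !mxE.
  have := M_fourier j (bqf_repr l i).
  by rewrite expansion fourierE bqf_class_repr // SE.
have Sy : S j y = S j (bqf_repr l (bqf_class y)) by exact: orbit_sumE.
by rewrite expansion fourierE Sy SE !mxE.
Qed.
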